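(* Let $(X,d)$ be a metric space such that $\partial X\le\beta$, with $\beta\ge0$, and containing five points having pairwise distances strictly greater than $30\beta$. Then there exists a map $f:(X,d)\to(\mathbb R,|\cdot|)$ that is a $40\beta$-isometry.
   Context: The triangular excess of three points of a metric space is $\partial(\{x_1,x_2,x_3\})=\min_{\sigma\in S_3}\{d(x_{\sigma(1)},x_{\sigma(2)})+d(x_{\sigma(2)},x_{\sigma(3)})-d(x_{\sigma(1)},x_{\sigma(3)})\}$. For $S\subset X$, $\partial S=\sup_{\{x,y,z\}\subset S}\partial(\{x,y,z\})$. A map $f:(X_1,d_1)\to(X_2,d_2)$ between metric spaces is a $\delta$-isometry ($\delta\ge0$) if $|d_2(f(x),f(y))-d_1(x,y)|\le\delta$ for all $x,y\in X_1$ (surjectivity is not required). *)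

(* Defs.v *)
From mathcomp Require Import all_boot all_order all_algebra all_fingroup.
From mathcomp Require Import all_classical all_reals all_analysis.

Set Implicit Arguments.
Unset Strict Implicit.
Unset Printing Implicit Defensive.

Import Order.TTheory GRing.Theory Num.Theory.
Import numFieldNormedType.Exports.

Local Open Scope classical_set_scope.
Local Open Scope ring_scope.

(* The numerals 0, 1, 2 are the three elements of 'I_3. *)
Definition triangle_defect (R : realType) (T : metricType R)
    (x : 'I_3 -> T) (s : 'S_3) : R :=
  mdist (x (s 0)) (x (s 1)) + mdist (x (s 1)) (x (s 2))
    - mdist (x (s 0)) (x (s 2)).

(* The default value of the iterated minimum is its term at the identity
   permutation, so it does not affect the result. *)
Definition triple_excess (R : realType) (T : metricType R)
    (x : 'I_3 -> T) : R :=
  \big[Num.min/triangle_defect x 1%g]_(s : 'S_3) triangle_defect x s.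

(* The supremum is taken in \bar R, as it may be infinite. The three points may
   coincide: a degenerate triple has excess 0, hence it does not affect an
   upper bound beta >= 0. *)
Definition triangular_excess (R : realType) (T : metricType R)
    (S : set T) : \bar R :=
  ereal_sup [set (triple_excess x)%:E | x in [set x : 'I_3 -> T |
                                              forall i, S (x i)]].

Definition delta_isometry (R : realType) (T1 T2 : metricType R)
    (delta : R) (f : T1 -> T2) : Prop :=
  forall x y : T1, `|mdist (f x) (f y) - mdist x y| <= delta.

(* Main.v *)
(** Fix two of the five points, a and b, at distance l. Since every triple is
    degenerate up to beta, each x gets a signed coordinate u with
    |u| = d(a, x) and |u - l| close to d(b, x). Comparing d(x, y) with the
    coordinates u and v through a gives |u - v| or |u + v|, and through b it
    gives |u - v| or |u + v - 2l|. Hence either d(x, y) is close to |u - v|, or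
    u + v and d(x, y) are both close to l and (a, b, x, y) is almost Menger's
    pseudo-linear quadruple. The latter is impossible: one of the three
    remaining points is far from x and y, and it would form a nondegenerate
    triangle with x and y. *)
Require Import Defs.
From mathcomp Require Import all_boot all_order all_algebra all_fingroup.
From mathcomp Require Import all_classical all_reals all_analysis.
From mathcomp Require Import ring lra.

Import Order.TTheory GRing.Theory Num.Theory.
Import numFieldNormedType.Exports.

Local Open Scope classical_set_scope.
Local Open Scope ring_scope.

Definition degenerate_triangle {R : realFieldType} (beta p q r : R) : Prop :=
  [\/ p + q <= r + beta, q + r <= p + beta | r + p <= q + beta].

(** Up to [beta], [r] is [p + q] or the difference of [p] and [q]; the signs of [u] and [v] decide
    which of these is [|u - v|] and which [|u + v|]. Replacing [p] and [q] costs [delta] each. *)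
Lemma degenerate_triangle_side {R : realFieldType} {beta delta p q r u v : R} :
    p <= q + r -> q <= r + p -> r <= p + q ->
    degenerate_triangle beta p q r ->
    `|p - `|u| | <= delta -> `|q - `|v| | <= delta ->
  `|r - `|u - v| | <= beta + 2 * delta \/ `|r - `|u + v| | <= beta + 2 * delta.
Proof.
move=> tp tq tr deg; rewrite !ler_norml => /andP[pu1 pu2] /andP[qv1 qv2].
have [u0|u0] := ger0P u; have [v0|v0] := ger0P v;
  (rewrite ?(ger0_norm u0) ?(ltr0_norm u0) in pu1 pu2;
   rewrite ?(ger0_norm v0) ?(ltr0_norm v0) in qv1 qv2);
  case: (ger0P (u - v)) => ?; case: (ger0P (u + v)) => ?;
  case: deg => ?; first [left; apply/andP; split; lra | right; apply/andP; split; lra].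
Qed.

(** Outside [[0, 2l]] the two absolute values would differ by [2l], but they differ by at most
    [4 * beta]. Inside, their difference is [2|s - l|]. *)
Lemma pseudolinear_sum {R : realFieldType} {beta l s r : R} :
    0 <= beta -> 30 * beta < l ->
    `|r - `|s| | <= beta -> `|r - `|s - 2 * l| | <= 3 * beta ->
  `|s - l| <= 2 * beta /\ `|r - l| <= 3 * beta.
Proof.
move=> b0 hl; rewrite !ler_norml.
case: (ger0P s) => ?; case: (ger0P (s - 2 * l)) => ? /andP[? ?] /andP[? ?];
  split; apply/andP; split; lra.
Qed.

Lemma no_fifth_point {R : realFieldType} {beta l u v w dxy dex dey : R} :
    0 <= beta -> 30 * beta < l ->
    `|u + v - l| <= 2 * beta -> `|dxy - l| <= 3 * beta ->
    40 * beta < `|dxy - `|u - v| | ->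
    30 * beta < `|w| -> 29 * beta < `|w - l| ->
    15 * beta < dex -> 15 * beta < dey ->
    dex <= dey + dxy -> dey <= dxy + dex -> dxy <= dex + dey ->
    `|dex - `|w - u| | <= 3 * beta \/
      `|w + u - l| <= 2 * beta /\ `|dex - l| <= 3 * beta ->
    `|dey - `|w - v| | <= 3 * beta \/
      `|w + v - l| <= 2 * beta /\ `|dey - l| <= 3 * beta ->
    ~ degenerate_triangle beta dex dey dxy.
Proof.
move=> b0 hl suv dl far w0 wl dx0 dy0 tx ty txy Hx Hy deg.
move: suv dl; rewrite !ler_norml => /andP[s1 s2] /andP[d1 d2].
case: Hx => [|[wu dxl]]; case: Hy => [|[wv dyl]].
- move=> yv xu.
  have [] := degenerate_triangle_side tx ty txy deg xu yv.
    rewrite (_ : w - u - (w - v) = - (u - v)); last by ring.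
    by rewrite normrN; move: far; lra.
  (* Here [dxy] is within [7 * beta] of [|2w - (u + v)|]. As [u + v] and [dxy] are close to [l], [w]
     is within [6 * beta] of [0] or [l]. *)
  move: w0 wl; rewrite ler_norml.
  case: (ger0P w) => ? ?; case: (ger0P (w - l)) => ? ?;
    by case: (ger0P (w - u + (w - v))) => ? /andP[? ?]; lra.
(* Both [u + v] and [w + v] are close to [l], so [|w - u| <= 4 * beta] and [dex] is too small. The
   next case is symmetric. *)
- move: wv dyl; rewrite !ler_norml => /andP[? ?] /andP[? ?].
  case: (ger0P (w - u)) => ? /andP[? ?]; lra.
- move: wu dxl; rewrite !ler_norml => /andP[? ?] /andP[? ?].
  case: (ger0P (w - v)) => ? /andP[? ?]; lra.
(* All three sides are close to [l]: an almost equilateral triangle is not degenerate. *)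
- move: wu dxl wv dyl; rewrite !ler_norml.
  move=> /andP[? ?] /andP[? ?] /andP[? ?] /andP[? ?].
  case: deg => ?; lra.
Qed.

(** With a at [0] and b at [l], the coordinate is negative when a lies almost between b and the
    point. *)
Lemma signed_coordinate {R : realFieldType} {beta l p q : R} :
    0 <= beta -> 0 <= p -> 0 <= q ->
    l <= p + q -> p <= q + l -> q <= l + p ->
    degenerate_triangle beta l p q ->
  exists u : R, p = `|u| /\ `|q - `|u - l| | <= beta.
Proof.
move=> b0 p0 q0 tl tp tq deg.
have [?|?] := lerP (l + p) (q + beta).
  exists (- p); rewrite normrN ger0_norm //; split=> //.
  by rewrite ler_norml; case: (ger0P (- p - l)) => ?; apply/andP; split; lra.
exists p; rewrite ger0_norm //; split=> //.
rewrite ler_norml; case: (ger0P (p - l)) => ?; case: deg => ?;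
  by apply/andP; split; lra.
Qed.

Lemma chart_dichotomy {R : realFieldType} {beta l r u v qx qy : R} :
    0 <= beta -> 30 * beta < l ->
    `|u| <= `|v| + r -> `|v| <= r + `|u| -> r <= `|u| + `|v| ->
    qx <= qy + r -> qy <= r + qx -> r <= qx + qy ->
    degenerate_triangle beta `|u| `|v| r -> degenerate_triangle beta qx qy r ->
    `|qx - `|u - l| | <= beta -> `|qy - `|v - l| | <= beta ->
  `|r - `|u - v| | <= 3 * beta \/
  `|u + v - l| <= 2 * beta /\ `|r - l| <= 3 * beta.
Proof.
move=> b0 hl t1 t2 t3 t4 t5 t6 dega degb xu yv.
(* Coordinates are exact distances from a ([delta = 0], error [beta]), but only [beta]-close from b
   (error [3 * beta]). *)
have nn (s : R) : `|s - s| <= 0 by rewrite subrr normr0.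
have [|sa] := degenerate_triangle_side t1 t2 t3 dega (nn _) (nn _).
  by move=> h; left; apply: (le_trans h); lra.
have [|sb] := degenerate_triangle_side t4 t5 t6 degb xu yv.
  rewrite (_ : u - l - (v - l) = u - v); last by ring.
  by move=> h; left; apply: (le_trans h); lra.
right; apply: pseudolinear_sum => //.
  by apply: (le_trans sa); lra.
rewrite (_ : u + v - 2 * l = u - l + (v - l)); last by ring.
by apply: (le_trans sb); lra.
Qed.

Lemma excess_degenerate {R : realType} {X : metricType R} {beta : R} :
    (triangular_excess [set: X] <= beta%:E)%E ->
  forall x y z : X, degenerate_triangle beta (mdist x y) (mdist y z) (mdist x z).
Proof.
move=> excess_le x y z.
pose t (i : 'I_3) := nth x [:: x; y; z] i.
have : triple_excess t <= beta.
  rewrite -lee_fin; apply: le_trans excess_le.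
  by apply: ereal_sup_ubound; exists t.
(* If every defect exceeded [beta], so would the minimum, default value included. *)
have [h _|h] := pselect (exists s : 'S_3, triangle_defect t s <= beta); last first.
  rewrite leNgt => /negP[]; apply: Order.POrderTheory.lt_bigmin => [|s _];
    by rewrite ltNge; apply/negP => hs; apply: h; eexists; exact: hs.
case: h => s; rewrite /triangle_defect.
have s01 : s 0 != s 1 by rewrite (inj_eq perm_inj).
have s12 : s 1 != s 2 by rewrite (inj_eq perm_inj).
have s02 : s 0 != s 2 by rewrite (inj_eq perm_inj).
(* The middle vertex [s 1] selects the alternative. *)
move: (s 0) (s 1) (s 2) s01 s12 s02
  => [[|[|[|//]]] ?] [[|[|[|//]]] ?] [[|[|[|//]]] ?] //= _ _ _;
  rewrite /t /= ?(metric_sym y x) ?(metric_sym z x) ?(metric_sym z y) => ?;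
  first [apply: Or31; lra | apply: Or32; lra | apply: Or33; lra].
Qed.

(** By the separation, each of [x] and [y] is within [c] of at most one of the points [2], [3], [4],
    so one of the three is left. *)
Lemma far_point {R : realType} {X : metricType R} {c : R} {p : 'I_5 -> X} :
    (forall i j : 'I_5, i != j -> 2 * c < mdist (p i) (p j)) ->
  forall x y : X, exists k : 'I_5,
    [/\ k != 0, k != 1, c < mdist (p k) x & c < mdist (p k) y].
Proof.
move=> sep x y.
have near1 (z : X) (i j : 'I_5) :
    i != j -> c < mdist (p i) z \/ c < mdist (p j) z.
  move=> /sep ij; have := metric_triangle (p i) z (p j).
  rewrite (metric_sym z (p j)).
  by have [?|?] := ltrP c (mdist (p i) z); [left | right; lra].
have n23 : (2 : 'I_5) != 3 by [].
have n24 : (2 : 'I_5) != 4 by [].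
have n34 : (3 : 'I_5) != 4 by [].
have [x2|x2] := ltrP c (mdist (p 2) x);
  [have [y2|y2] := ltrP c (mdist (p 2) y); first by exists 2|].
- have [x3|x4] := near1 x _ _ n34.
    have [|y3] := near1 y _ _ n23; first by lra.
    by exists 3.
  have [|y4] := near1 y _ _ n24; first by lra.
  by exists 4.
- have [|x3] := near1 x _ _ n23; first by lra.
  have [|x4] := near1 x _ _ n24; first by lra.
  by have [y3|y4] := near1 y _ _ n34; [exists 3 | exists 4].
Qed.

(* R^o carries the metric mdist x y = `|y - x|. *)
Theorem theorem4p27 (R : realType) (X : metricType R) (beta : R)
    (beta_ge0 : 0 <= beta)
    (excess_le : (triangular_excess [set: X] <= beta%:E)%E)
    (five_points : exists p : 'I_5 -> X,
      forall i j : 'I_5, i != j -> 30 * beta < mdist (p i) (p j)) :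
  exists f : X -> R^o, delta_isometry (40 * beta) f.
Proof.
have deg := excess_degenerate excess_le.
case: five_points => p sep.
have sep' (i j : 'I_5) : i != j -> 2 * (15 * beta) < mdist (p i) (p j).
  by move=> /sep; lra.
pose a := p 0; pose b := p 1; pose l := mdist a b.
have hl : 30 * beta < l by exact: sep.
have tri (x y z : X) : mdist x z <= mdist x y + mdist y z.
  exact: metric_triangle.
have chart (x : X) : exists u : R,
    mdist a x = `|u| /\ `|mdist b x - `|u - l| | <= beta.
  apply: (signed_coordinate beta_ge0); rewrite ?mdist_ge0 //.
  - by rewrite /l (metric_sym b x); exact: tri.
  - by rewrite addrC; exact: tri.
  - by rewrite /l (metric_sym a b); exact: tri.
  - by case: (deg a b x) => ?;
      [apply: Or33|apply: Or32|apply: Or31]; rewrite /l; lra.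
have [f /all_and2[fa fb]] := choice chart.
have dich (x y : X) : `|mdist x y - `|f x - f y| | <= 3 * beta \/
    `|f x + f y - l| <= 2 * beta /\ `|mdist x y - l| <= 3 * beta.
  apply: (chart_dichotomy beta_ge0 hl _ _ _ _ _ _ _ _ (fb x) (fb y));
    rewrite -?fa.
  - by rewrite (metric_sym x y); exact: tri.
  - by rewrite addrC; exact: tri.
  - by rewrite (metric_sym a x); exact: tri.
  - by rewrite (metric_sym x y); exact: tri.
  - by rewrite addrC; exact: tri.
  - by rewrite (metric_sym b x); exact: tri.
  - by case: (deg a x y) => ?; [apply: Or33|apply: Or32|apply: Or31]; lra.
  - by case: (deg b x y) => ?; [apply: Or33|apply: Or32|apply: Or31]; lra.
exists f => x y.
have -> : mdist (f x : R^o) (f y : R^o) = `|f y - f x| by [].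
rewrite distrC [X in _ - X]distrC leNgt; apply/negP => far.
have [|[sxy dxy]] := dich x y; first by lra.
have [k [k0 k1 kx ky]] := far_point sep' x y.
apply: (@no_fifth_point _ beta l (f x) (f y) (f (p k)) (mdist x y)
  (mdist (p k) x) (mdist (p k) y)) => //.
- by rewrite -fa; apply: sep; rewrite eq_sym.
(* Passing from the distance to b to [|f (p k) - l|] loses [beta], whence [29 * beta]. *)
- have : 30 * beta < mdist b (p k) by apply: sep; rewrite eq_sym.
  by have := fb (p k); rewrite ler_norml => /andP[_ ?] ?; lra.
- by rewrite (metric_sym x y); exact: tri.
- by rewrite addrC; exact: tri.
- by rewrite (metric_sym (p k) x); exact: tri.
by case: (deg (p k) x y) => ?; [apply: Or33|apply: Or32|apply: Or31]; lra.
Qed.
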